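(* Let $f_{\min}>-\infty$ and suppose $K$ is closed at $\infty$. Then a point $x^*\in K$ is a minimizer of (P) if and only if $\tilde x^*:=(1,x^* )/\sqrt{1+\|x^*\|^2}$ is a minimizer of (H). Moreover, for such a minimizer $x^*$: (i) The LICQC holds for (P) at $x^*$ if and only if it holds for (H) at $\tilde x^*$. (ii) Suppose the LICQC holds for (P) at $x^*$. Then the SCC holds for (P) at $x^*$ if and only if it holds for (H) at $\tilde x^*$. (iii) Suppose the LICQC holds for (P) at $x^*$. Then the SOSC holds for (P) at $x^*$ if and only if it holds for (H) at $\tilde x^*$.
   Context: **Problem.** $\mathcal E,\mathcal I$ are disjoint finite label sets; $f,c_i\ (i\in\mathcal E\cup\mathcal I)$ are real polynomials in $x=(x_1,\dots,x_n)$; $d=\deg f$. Problem (P): minimize $f(x)$ subject to $c_i(x)=0\ (i\in\mathcal E)$, $c_j(x)\ge 0\ (j\in\mathcal I)$. $K$ is its feasible set and $f_{\min}=\inf_K f$. ''Minimizer'' means global minimizer. **Homogenization.** $\tilde x=(x_0,x)\in\mathbb R^{n+1}$; $\tilde p(\tilde x)=x_0^{\deg p}p(x/x_0)$. Let $\widetilde K^h=\{\tilde x:\tilde c_i(\tilde x)=0\,(i\in\mathcal E),\ \tilde c_j(\tilde x)\ge0\,(j\in\mathcal I),\ x_0\ge0\}$ and $\widetilde K^c=\widetilde K^h\cap\{x_0>0\}$. $K$ (with its given description) is closed at $\infty$ if the closure of $\widetilde K^c$ equals $\widetilde K^h$. Homogenized problem (H): minimize $F(\tilde x)=\tilde f(\tilde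 x)-f_{\min}x_0^d$ subject to $\tilde c_i(\tilde x)=0\ (i\in\mathcal E)$, $\|\tilde x\|^2-1=0$, $\tilde c_j(\tilde x)\ge0\ (j\in\mathcal I)$, $x_0\ge0$. **Optimality conditions.** For a problem $\min\phi(u)$ s.t. $h_i(u)=0\ (i\in E)$, $h_j(u)\ge0\ (j\in I)$ and a local minimizer $u^*$, let $J(u^* )=\{i\in E\cup I: h_i(u^* )=0\}$. LICQC: the gradients $\nabla h_i(u^* )$, $i\in J(u^* )$, are linearly independent. Under LICQC there are unique multipliers $\lambda_i$ with $\nabla\phi(u^* )=\sum_{i\in E\cup I}\lambda_i\nabla h_i(u^* )$, $\lambda_j\ge0$ and $\lambda_jh_j(u^* )=0$ for $j\in I$. SCC: $\lambda_j+h_j(u^* )>0$ for all $j\in I$. SOSC: $v^T\nabla^2\mathscr L(u^* )v>0$ for all $v\ne0$ orthogonal to all $\nabla h_i(u^* )$, $i\in J(u^* )$, where $\mathscr L=\phi-\sum_i\lambda_ih_i$. *)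

(* Defs.v *)
From HB Require Import structures.
From mathcomp Require Import all_boot all_order all_algebra.
From mathcomp Require Import mpoly.
From mathcomp Require Import boolp classical_sets reals ereal topology normedtype.
Import Order.TTheory GRing.Theory Num.Theory.
Import numFieldNormedType.Exports.

Set Implicit Arguments.
Unset Strict Implicit.
Unset Printing Implicit Defensive.

Local Open Scope classical_set_scope.
Local Open Scope ring_scope.

(* A problem "min phi s.t. h_i = 0 (i in E), h_j >= 0 (j in I)" is given by   *)
(* phi and one family h : E + I -> {mpoly R[n]}: the disjoint union E + I is  *)
(* the set of all labels, inl marks equalities and inr inequalities.          *)
Section Problem.
Context {R : realType} {n : nat} {E I : finType}.
Implicit Types (phi p : {mpoly R[n]}) (h : E + I -> {mpoly R[n]}).
Implicit Types (u v : 'rV[R]_n) (lam : E + I -> R).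

Definition feasible h : set 'rV[R]_n :=
  [set u | (forall i : E, (h (inl i)).@[u 0] = 0) /\
           (forall j : I, 0 <= (h (inr j)).@[u 0])].

Definition minimizer phi h u : Prop :=
  feasible h u /\ forall v, feasible h v -> phi.@[u 0] <= phi.@[v 0].

Definition optval phi h : \bar R :=
  ereal_inf [set (phi.@[u 0])%:E | u in feasible h].

Definition gradient p u : 'rV[R]_n := \row_i (p^`M(i)).@[u 0].

Definition hessian p u : 'M[R]_n := \matrix_(i, j) ((p^`M(i))^`M(j)).@[u 0].

Definition active h u : pred (E + I) := [pred i | (h i).@[u 0] == 0].

(* The sequence keeps repetitions, so two labels with equal gradients (or one *)
(* label with a null gradient) make the family dependent.                     *)
Definition LICQC h u : bool := free [seq gradient (h i) u | i in active h u].

Definition multipliers phi h u lam : Prop :=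
  gradient phi u = \sum_i lam i *: gradient (h i) u /\
  forall j : I, 0 <= lam (inr j) /\ lam (inr j) * (h (inr j)).@[u 0] = 0.

Definition lagrangian phi h lam : {mpoly R[n]} :=
  phi - \sum_i lam i *: h i.

(* SCC and SOSC refer to "the" multipliers at u; these are unique when the    *)
(* LICQC holds at u.                                                          *)
Definition SCC phi h u : Prop :=
  exists2 lam, multipliers phi h u lam &
    forall j : I, 0 < lam (inr j) + (h (inr j)).@[u 0].

Definition SOSC phi h u : Prop :=
  exists2 lam, multipliers phi h u lam &
    forall v, v != 0 ->
      (forall i, active h u i -> v *m (gradient (h i) u)^T = 0) ->
      0 < (v *m hessian (lagrangian phi h lam) u *m v^T) 0 0.

End Problem.

Section Homogenization.
Context {R : realType} {n : nat} {E I : finType}.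
Implicit Types (f p : {mpoly R[n]}) (c : E + I -> {mpoly R[n]}).

(* msize p is 1 + the total degree of p, and msize 0 = 0; hence pdeg 0 = 0.   *)
Definition pdeg p : nat := (msize p).-1.

(* x_0 is the variable of index ord0 and x_i the one of index lift ord0 i;    *)
(* the characterization by x_0 ^ deg p * p (x / x_0) is homogenizeE below.    *)
Definition homogenize p : {mpoly R[n.+1]} :=
  \sum_(m <- msupp p) p@_m *: 'X_[[multinom of (pdeg p - mdeg m)%N :: m]].

Definition hvec (x0 : R) (x : 'rV[R]_n) : 'rV[R]_n.+1 := row_mx x0%:M x.

Lemma hvec0 x0 x : hvec x0 x 0 ord0 = x0.
Proof.
rewrite /hvec; have -> : ord0 = lshift n (0 : 'I_1) by apply/val_inj.
by rewrite (@row_mxEl _ 1 1 n) mxE eqxx mulr1n.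
Qed.

Lemma hvecS x0 x i : hvec x0 x 0 (lift ord0 i) = x 0 i.
Proof.
rewrite /hvec; have -> : lift ord0 i = rshift 1 i by apply/val_inj.
by rewrite (@row_mxEr _ 1 1 n).
Qed.

Lemma homogenizeE p (x0 : R) (x : 'rV[R]_n) : x0 != 0 ->
  (homogenize p).@[hvec x0 x 0] = x0 ^+ pdeg p * p.@[(x0^-1 *: x) 0].
Proof.
move=> x0n0; rewrite /homogenize [in p.@[_]](mpolyE p).
rewrite !raddf_sum /= mulr_sumr big_seq [RHS]big_seq; apply: eq_bigr => m mp.
rewrite !mevalZ !mevalX mulrCA; congr (_ * _).
rewrite big_ord_recl hvec0 /=.
have le_md : (mdeg m <= pdeg p)%N.
  by have := msize_mdeg_lt mp; rewrite /pdeg; case: (msize p).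
have -> : [multinom of (pdeg p - mdeg m)%N :: m] ord0 = (pdeg p - mdeg m)%N.
  by rewrite multinomE.
under eq_bigr => i _ do rewrite hvecS.
rewrite [in RHS](eq_bigr (fun i => (x0 ^+ m i)^-1 * x 0 i ^+ m i)); last first.
  by move=> i _; rewrite mxE exprMn exprVn.
rewrite big_split /= prodfV prodrXr -mdegE -[in RHS](subnK le_md) exprD.
rewrite !mulrA mulfK ?expf_neq0 //; congr (_ * _).
by apply: eq_bigr => i _; rewrite multinomE (tnth_nth 0%N) /= -mnm_nth.
Qed.

Definition hcone c : set 'rV[R]_n.+1 :=
  [set y | [/\ forall i : E, (homogenize (c (inl i))).@[y 0] = 0,
               forall j : I, 0 <= (homogenize (c (inr j))).@[y 0] &
               0 <= y 0 ord0]].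

Definition hcone_pos c : set 'rV[R]_n.+1 :=
  hcone c `&` [set y | 0 < y 0 ord0].

Definition closed_at_infinity c : Prop := closure (hcone_pos c) = hcone c.

(* The optimal value is used as a real number: fine is the identity on finite *)
(* extended reals.                                                            *)
Definition hobjective f c : {mpoly R[n.+1]} :=
  homogenize f - fine (optval f c) *: 'X_ord0 ^+ pdeg f.

(* inl None is the sphere ||y||^2 - 1 = 0, and inr None is y_0 >= 0.          *)
Definition hconstraints c (k : option E + option I) : {mpoly R[n.+1]} :=
  match k with
  | inl (Some i) => homogenize (c (inl i))
  | inl None => \sum_(l < n.+1) 'X_l ^+ 2 - 1
  | inr (Some j) => homogenize (c (inr j))
  | inr None => 'X_ord0
  end.

(* Euclidean norm; the library norm `|x| on 'rV[R]_n is the sup norm.         *)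
Definition hpoint (x : 'rV[R]_n) : 'rV[R]_n.+1 :=
  (Num.sqrt (1 + \sum_i x 0 i ^+ 2))^-1 *: hvec 1 x.

End Homogenization.

(* Main.v *)
(* For y = t (1, x) with t > 0 one has p~(y) = t^deg p p(x), so feasibility    *)
(* and the sign of F transfer from K to the cone x_0 > 0, and by continuity to *)
(* its closure, which is the whole feasible cone. Locally at a minimizer,      *)
(* f(x) = fmin and the active constraints are the homogenizations of those     *)
(* active at x, plus the sphere. Euler's identity makes every relevant         *)
(* homogenized gradient orthogonal to y, so it is determined by its last n     *)
(* entries, which are t^(deg p - 1) times the gradient of p; pairing with y    *)
(* shows that the multiplier of the sphere vanishes. Multipliers therefore     *)
(* correspond up to positive factors. A tangent vector v equals a y + (0, w)   *)
(* with w = v' - v_0 x tangent at x, and Euler's identity for the gradient     *)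
(* removes the y-part from the quadratic form of the Hessian.                  *)

Require Import Defs.
From HB Require Import structures.
From mathcomp Require Import all_boot all_order all_algebra.
From mathcomp Require Import ssrcomplements mpoly.
From mathcomp Require Import boolp classical_sets reals ereal topology normedtype.
Import Order.TTheory GRing.Theory Num.Theory.
Import numFieldNormedType.Exports.

Set Implicit Arguments.
Unset Strict Implicit.
Unset Printing Implicit Defensive.

Local Open Scope classical_set_scope.
Local Open Scope ring_scope.

(** * Homogenization of polynomials *)

Section Homogenization.
Context {R : realType} {n : nat}.
Implicit Types (p : {mpoly R[n]}) (m : 'X_{1..n}) (D : nat) (i : 'I_n).

(** On the half-space x_0 > 0 the chart z -> z / x_0 turns the homogenized problem back into the
    original one. There F is the homogenization, in degree deg f, of f - fmin ([hobjectiveE]), hence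
    a positive multiple of f - fmin, and closedness at infinity carries the bound F >= 0 to the
    whole cone ([hobjective_ge0]). So a feasible x is a minimizer exactly when F vanishes at y =
    [hpoint x] ([minimizer_hpoint]).

    For the local conditions, f - fmin and the active constraints all vanish at x, so by Euler's
    identity ([hom_euler]) the gradients of their homogenizations at y are orthogonal to y, while
    the gradient of the sphere is a multiple of y. A linear relation between these gradients thus
    splits into a zero coefficient for the sphere and a rescaled relation at x. This is
    [gradient_combination]; it gives [LICQC_hpoint] for the zero polynomial and [multipliers_hpoint]
    for f - fmin. The rescaling is positive, which gives [SCC_hpoint]. For [SOSC_hpoint], [tproj]
    identifies the tangent spaces at y and at x, and the Hessians of the two Lagrangians differ on
    them by a positive factor ([hessian_lagrangian]). *)

Definition hommon D m : 'X_{1..n.+1} := [multinom of (D - mdeg m)%N :: m].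

Lemma hommon0 D m : hommon D m ord0 = (D - mdeg m)%N.
Proof. by rewrite /hommon multinomE. Qed.

Lemma hommonS D m i : hommon D m (lift ord0 i) = m i.
Proof. by rewrite /hommon multinomE (tnth_nth 0%N) /= -mnm_nth. Qed.

Lemma mdeg_hommon D m : (mdeg m <= D)%N -> mdeg (hommon D m) = D.
Proof.
move=> le_mD; rewrite mdegE big_ord_recl hommon0.
by under eq_bigr do rewrite hommonS; rewrite -mdegE subnK.
Qed.

(* Homogenization with respect to any degree bound D, so that it is linear in *)
(* p and commutes with d/dx_i.                                                *)
Definition hom D p : {mpoly R[n.+1]} :=
  \sum_(m <- msupp p) p@_m *: 'X_[hommon D m].

Lemma homogenizeE_hom p : homogenize p = hom (pdeg p) p.
Proof. by []. Qed.

(** An index set common to several polynomials lets their sums be added termwise, which gives the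
    linearity of [hom D]. *)
Lemma homwE D p k : (msize p <= k)%N ->
  hom D p = \sum_(m : 'X_{1..n < k}) p@_m *: 'X_[hommon D m].
Proof.
pose I : subFinType _ := 'X_{1..n < k}.
move=> le_pk; rewrite /hom (big_mksub I) /=; first last.
  by move=> x /msize_mdeg_lt/leq_trans/(_ le_pk).
  by rewrite msupp_uniq.
by rewrite big_rmcond //= => j /memN_msupp_eq0 ->; rewrite scale0r.
Qed.

Lemma hom_is_linear D : linear (hom D).
Proof.
move=> a p q; pose k := maxn (msize (a *: p + q)) (maxn (msize p) (msize q)).
rewrite !(@homwE D _ k) ?leq_max ?leqnn ?orbT // scaler_sumr -big_split /=.
by apply: eq_bigr => m _; rewrite mcoeffD mcoeffZ scalerDl scalerA.
Qed.

HB.instance Definition _ D :=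
  GRing.isLinear.Build R {mpoly R[n]} {mpoly R[n.+1]} _
    (hom D) (hom_is_linear D).

Lemma homX D m : hom D 'X_[m] = 'X_[hommon D m].
Proof. by rewrite /hom msuppX big_seq1 mcoeffX eqxx scale1r. Qed.

Lemma homC D a : hom D a%:MP = a *: 'X_ord0 ^+ D.
Proof.
rewrite -[a%:MP]mulr1 mul_mpolyC linearZ /= -mpolyX0 homX mpolyXn.
congr (_ *: 'X_[_]); apply/mnmP => k; rewrite mulmnE mnm1E.
case: (unliftP ord0 k) => [j ->|->].
  by rewrite hommonS mnm0E.
by rewrite hommon0 mdeg0 subn0 eqxx mul1n.
Qed.

(** Reduces identities about [hom D] to monomials of degree at most D, the only ones that [hom D]
    makes homogeneous of degree D. *)
Lemma mpoly_linear_eq (V : lmodType R) (g h : {mpoly R[n]} -> V) D p :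
  linear g -> linear h -> (forall m, (mdeg m <= D)%N -> g 'X_[m] = h 'X_[m]) ->
  (msize p <= D.+1)%N -> g p = h p.
Proof.
move=> gL hL eq_gh le_pD.
pose gM := GRing.isLinear.Build _ _ _ _ g gL.
pose hM := GRing.isLinear.Build _ _ _ _ h hL.
pose gl : {linear {mpoly R[n]} -> V} := HB.pack g gM.
pose hl : {linear {mpoly R[n]} -> V} := HB.pack h hM.
suff : gl p = hl p by [].
rewrite [p]mpolyE !linear_sum big_seq [RHS]big_seq.
apply: eq_bigr => m mp; rewrite !linearZ /= eq_gh //.
by rewrite -ltnS (leq_trans (msize_mdeg_lt mp)).
Qed.

(** On a monomial containing x_i, the derivative lowers both D and the degree by one, so the
    exponent of x_0 does not change. *)
Lemma hom_deriv D p i : (msize p <= D.+1)%N ->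
  (hom D p)^`M(lift ord0 i) = hom D.-1 p^`M(i).
Proof.
apply: (mpoly_linear_eq (g := fun p => (hom D p)^`M(_)) (h := hom D.-1 \o _)).
- by move=> a q r; rewrite !linearP.
- by move=> a q r; rewrite /= !linearP.
move=> m le_mD; rewrite /= homX !mderivX hommonS linearZ /= homX.
have [->|mi_gt0] := posnP (m i); first by rewrite !scale0r.
congr (_ *: 'X_[_]).
have mE : m = (m - U_(i) + U_(i))%MM.
  by rewrite submK //; apply/mnm_lepP => j; rewrite mnm1E; case: eqP => // <-.
apply/mnmP => k; rewrite mnmBE; case: (unliftP ord0 k) => [j ->|->].
  by rewrite !hommonS mnmBE !mnm1E (inj_eq lift_inj).
rewrite !hommon0 mnm1E /= subn0 {1}mE mdegD mdeg1 addn1.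
by case: D le_mD => [|D] _ //=; rewrite sub0n.
Qed.

Lemma msize_deriv D p i : (msize p <= D.+1)%N -> (msize p^`M(i) <= D.-1.+1)%N.
Proof.
move=> le_pD; rewrite [msize _]mmeasureE; apply/bigmax_leqP_seq => m mp _.
have /msize_mdeg_lt : (m + U_(i))%MM \in msupp p.
  move: mp; rewrite !mcoeff_msupp mcoeff_deriv.
  by apply: contraNneq => ->; rewrite mul0rn.
rewrite mdegD mdeg1 addn1 => /leq_trans/(_ le_pD).
by case: D {le_pD}.
Qed.

(** Euler's identity: a monomial gets multiplied by the sum of its exponents, which is D after
    homogenization. *)
Lemma hom_euler D p : (msize p <= D.+1)%N ->
  \sum_k 'X_k * (hom D p)^`M(k) = D%:R *: hom D p.
Proof.
apply: (mpoly_linear_eq (g := fun p => \sum_k 'X_k * (hom D p)^`M(k))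
                         (h := fun p => D%:R *: hom D p)).
- move=> a q r; rewrite scaler_sumr -big_split; apply: eq_bigr => k _ /=.
  by rewrite !linearP /= mulrDr scalerAr.
- by move=> a q r; rewrite linearP scalerDr !scalerA mulrC.
move=> m le_mD; rewrite homX.
have -> : (D%:R : R) = \sum_k (hommon D m k)%:R.
  by rewrite -natr_sum -mdegE mdeg_hommon.
rewrite scaler_suml; apply: eq_bigr => k _; rewrite mderivX -scalerAr -mpolyXD.
have [->|mk_gt0] := posnP (hommon D m k); first by rewrite !scale0r.
congr (_ *: 'X_[_]); rewrite addmC submK //.
by apply/mnm_lepP => j; rewrite mnm1E; case: eqP => // <-.
Qed.

(** Raising the degree from [pdeg p] to D only multiplies the homogenization by a power of x_0, so
    [homogenizeE] applies. *)
Lemma hom_meval D p (t : R) (x : 'rV[R]_n) : t != 0 -> (msize p <= D.+1)%N ->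
  (hom D p).@[hvec t (t *: x) 0] = t ^+ D * p.@[x 0].
Proof.
move=> t0 le_pD; have -> : hom D p = 'X_ord0 ^+ (D - pdeg p) * homogenize p.
  rewrite homogenizeE_hom /hom mulr_sumr big_seq [RHS]big_seq.
  apply: eq_bigr => m mp; rewrite -scalerAr mpolyXn -mpolyXD.
  congr (_ *: 'X_[_]); apply/mnmP => k; rewrite mnmDE mulmnE mnm1E.
  case: (unliftP ord0 k) => [j ->|->]; first by rewrite !hommonS.
  rewrite !hommon0 eqxx mul1n addnBA ?subnK //.
    by rewrite /pdeg; case: (msize p) le_pD.
  by have := msize_mdeg_lt mp; rewrite /pdeg; case: (msize p).
rewrite mevalM homogenizeE // rmorphXn /= mevalXU hvec0 mulrA -exprD subnK.
  by rewrite scalerA mulVf // scale1r.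
by rewrite /pdeg; case: (msize p) le_pD.
Qed.

End Homogenization.

(** * Gradients and Hessians *)

Section PointwiseCalculus.
Context {R : realType} {n : nat}.
Implicit Types (p : {mpoly R[n]}) (D : nat) (u v : 'rV[R]_n).

Lemma hessianB p q u : hessian (p - q) u = hessian p u - hessian q u.
Proof. by apply/matrixP => i j; rewrite !mxE !mderivB mevalB. Qed.

Lemma hessianZ (a : R) p u : hessian (a *: p) u = a *: hessian p u.
Proof. by apply/matrixP => i j; rewrite !mxE !mderivZ mevalZ. Qed.

Lemma hessian_sum (T : finType) (F : T -> {mpoly R[n]}) u :
  hessian (\sum_k F k) u = \sum_k hessian (F k) u.
Proof.
apply/matrixP => i j; rewrite mxE summxE (raddf_sum (mderiv i)).
rewrite (raddf_sum (mderiv j)) (raddf_sum (meval _)) /=.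
by apply: eq_bigr => k _; rewrite mxE.
Qed.

Lemma trmx_hessian p u : (hessian p u)^T = hessian p u.
Proof. by apply/matrixP => i j; rewrite !mxE mderiv_comm. Qed.

Lemma meval_mderivXU (k l : 'I_n) (w : 'I_n -> R) :
  (('X_k)^`M(l)).@[w] = (k == l)%:R.
Proof.
rewrite mderivX mnm1E mevalZ; case: eqP => [->|_]; last by rewrite mul0r.
have -> : (U_(l) - U_(l) = 0)%MM by apply/mnmP => j; rewrite mnmBE subnn mnm0E.
by rewrite mpolyX0 meval1 mulr1.
Qed.

Lemma meval_continuous p : continuous (fun u : 'rV[R]_n => p.@[u 0]).
Proof.
have contX i k : continuous (fun u : 'rV[R]_n => u 0 i ^+ k).
  elim: k => [|k IHk] u; first exact: cst_continuous.
  under [fun u => _]eq_fun do rewrite exprS.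
  by apply: cvgM (IHk u); apply: coord_continuous.
have contM m : continuous (fun u : 'rV[R]_n => \prod_i u 0 i ^+ m i).
  by apply: continuous_big => [|i _]; [exact: mul_continuous | exact: contX].
under [fun u => _]eq_fun do rewrite mevalE.
apply: continuous_big => [|m _ u]; first exact: add_continuous.
by apply: (@cvgM _ _ (nbhs u)); [exact: cvg_cst | exact: contM].
Qed.

End PointwiseCalculus.

(** * First and second derivatives of a homogenization at y = (t, t x) *)

Section Dehomogenization.
Context {R : realType} {n : nat} (t : R) (x : 'rV[R]_n) (t0 : t != 0).
Implicit Types (p : {mpoly R[n]}) (D : nat) (z v : 'rV[R]_n.+1).

Local Notation y := (hvec t (t *: x)).
Local Notation dotT z v := ((z *m v^T) 0 0).

Lemma mderiv_const p i : (msize p <= 1)%N -> p^`M(i) = 0.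
Proof.
move=> p1; apply/mpolyP => m.
rewrite mcoeff_deriv mcoeff0 memN_msupp_eq0 ?mul0rn //.
by apply/negP => /msize_mdeg_lt/leq_trans/(_ p1); rewrite mdegD mdeg1 addn1.
Qed.

(** The factor is t^(D-1), written as a quotient to cover D = 0, where p is constant and both sides
    vanish. *)
Lemma hom_gradient_tail D p i : (msize p <= D.+1)%N ->
  gradient (hom D p) y 0 (lift ord0 i) = t ^+ D / t * gradient p x 0 i.
Proof.
move=> le_pD; rewrite !mxE hom_deriv // hom_meval ?msize_deriv //.
case: D le_pD => [|D] le_pD; last by rewrite exprSr mulfK.
by rewrite mderiv_const // meval0 !mulr0.
Qed.

Lemma hom_hessian_tail D p i j : (msize p <= D.+1)%N ->
  hessian (hom D p) y (lift ord0 i) (lift ord0 j) =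
  t ^+ D / t ^+ 2 * hessian p x i j.
Proof.
move=> le_pD; rewrite !mxE hom_deriv //.
have := hom_gradient_tail j (msize_deriv i le_pD); rewrite !mxE => ->.
case: D le_pD => [|D] le_pD; last by rewrite exprSr expr2 invfM mulrA mulfK.
by rewrite (mderiv_const i le_pD) mderiv0 meval0 !mulr0.
Qed.

Lemma dotTE z v : dotT z v =
  z 0 ord0 * v 0 ord0 + \sum_i z 0 (lift ord0 i) * v 0 (lift ord0 i).
Proof. by rewrite mxE big_ord_recl mxE; under eq_bigr do rewrite mxE. Qed.

Lemma euler_gradient D p : (msize p <= D.+1)%N ->
  y *m (gradient (hom D p) y)^T = (D%:R * (hom D p).@[y 0])%:M.
Proof.
move=> le_pD; apply/rowP => i; rewrite ord1 mxE [RHS]mxE eqxx mulr1n.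
rewrite -mevalZ -(hom_euler le_pD) (raddf_sum (meval _)) /=.
apply: eq_bigr => k _.
by rewrite mevalM mevalXU; congr (_ * _); rewrite !mxE.
Qed.

(** Differentiating Euler's identity in x_l produces the l-th partial derivative once more, whence D
    - 1 in place of D. *)
Lemma euler_hessian D p : (msize p <= D.+1)%N ->
  y *m hessian (hom D p) y = (D%:R - 1) *: gradient (hom D p) y.
Proof.
move=> le_pD; apply/rowP => l; rewrite [RHS]mxE [X in _ * X]mxE mulrBl mul1r.
have /(congr1 (fun q => (mderiv l q).@[y 0])) := hom_euler le_pD.
rewrite mderivZ mevalZ (raddf_sum (mderiv l)) (raddf_sum (meval _)) /= => <-.
under eq_bigr do rewrite mderivM mevalD !mevalM mevalXU.
rewrite big_split /= [X in X + _ - _](bigD1 l) //= meval_mderivXU eqxx mul1r.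
rewrite big1 => [|i /negPf neq_il]; last by rewrite meval_mderivXU neq_il mul0r.
rewrite addr0 addrAC subrr add0r mxE; apply: eq_bigr => k _.
by congr (_ * _); rewrite mxE.
Qed.

(** Since y_0 = t is nonzero, orthogonality to y determines the entry of index 0 from the others. *)
Lemma eq_hvec_tail z :
  z *m y^T = 0 -> (forall i, z 0 (lift ord0 i) = 0) -> z = 0.
Proof.
move=> zy zS; apply/rowP => k; rewrite [RHS]mxE.
case: (unliftP ord0 k) => [j ->//|->]; move/rowP/(_ 0): zy.
rewrite dotTE [RHS]mxE big1 => [|i _]; last by rewrite zS mul0r.
by rewrite addr0 hvec0 => /eqP; rewrite mulf_eq0 (negPf t0) orbF => /eqP.
Qed.

(** This is t times the differential at y of the chart z -> z / x_0; its kernel is the line through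
    y. *)
Definition tproj v : 'rV[R]_n := \row_i (v 0 (lift ord0 i) - v 0 ord0 * x 0 i).

Lemma tprojK v : v = (v 0 ord0 / t) *: y + hvec 0 (tproj v).
Proof.
apply/rowP => k; rewrite mxE [X in X + _]mxE.
case: (unliftP ord0 k) => [j ->|->]; last by rewrite !hvec0 addr0 divfK.
by rewrite !hvecS !mxE mulrA divfK // addrC subrK.
Qed.

Lemma hvec_gradient D p (w : 'rV[R]_n) : (msize p <= D.+1)%N ->
  hvec 0 w *m (gradient (hom D p) y)^T =
  (t ^+ D / t) *: (w *m (gradient p x)^T).
Proof.
move=> le_pD; apply/rowP => k; rewrite ord1 dotTE hvec0 mul0r add0r.
rewrite [RHS]mxE [X in _ * X]mxE mulr_sumr; apply: eq_bigr => i _.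
by rewrite hvecS hom_gradient_tail // mulrCA [in RHS]mxE.
Qed.

Lemma hvec_hessian D p (w : 'rV[R]_n) : (msize p <= D.+1)%N ->
  hvec 0 w *m hessian (hom D p) y *m (hvec 0 w)^T =
  (t ^+ D / t ^+ 2) *: (w *m hessian p x *m w^T).
Proof.
move=> le_pD; apply/rowP => k; rewrite ord1 dotTE hvec0 mulr0 add0r.
rewrite [RHS]mxE [X in _ * X]mxE mulr_sumr; apply: eq_bigr => i _.
rewrite hvecS [X in X * _]mxE big_ord_recl hvec0 mul0r add0r mulrA.
congr (_ * _); last by rewrite mxE.
rewrite mxE mulr_sumr; apply: eq_bigr => j _.
by rewrite hvecS hom_hessian_tail // mulrCA.
Qed.

Lemma gradient_tproj D p v : (msize p <= D.+1)%N -> p.@[x 0] = 0 ->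
  v *m (gradient (hom D p) y)^T = (t ^+ D / t) *: (tproj v *m (gradient p x)^T).
Proof.
move=> le_pD p0; rewrite [in LHS](tprojK v) mulmxDl -scalemxAl.
rewrite euler_gradient // hom_meval // p0 !mulr0 raddf0 scaler0 add0r.
exact: hvec_gradient.
Qed.

(** In both arguments v splits as a multiple of y plus (0, [tproj v]). By [euler_hessian] the
    Hessian sends y to a multiple of the gradient, which is orthogonal to v and to (0, [tproj v]),
    so only the last block contributes. *)
Lemma hessian_tproj D p v : (msize p <= D.+1)%N -> p.@[x 0] = 0 ->
  tproj v *m (gradient p x)^T = 0 ->
  v *m hessian (hom D p) y *m v^T =
  (t ^+ D / t ^+ 2) *: (tproj v *m hessian p x *m (tproj v)^T).
Proof.
move=> le_pD p0 vg0.
have orth z : z *m (gradient (hom D p) y)^T = 0 ->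
    gradient (hom D p) y *m z^T = 0.
  by move=> z0; apply: trmx_inj; rewrite trmx_mul trmxK z0 trmx0.
have Gv : gradient (hom D p) y *m v^T = 0.
  by apply: orth; rewrite gradient_tproj // vg0 scaler0.
have Gh : gradient (hom D p) y *m (hvec 0 (tproj v))^T = 0.
  by apply: orth; rewrite hvec_gradient // vg0 scaler0.
rewrite {1}(tprojK v) !mulmxDl -!scalemxAl euler_hessian //.
rewrite -scalemxAl Gv !scaler0 add0r.
rewrite {2}(tprojK v) linearD mulmxDr hvec_hessian // linearZ /= -scalemxAr.
suff -> : hvec 0 (tproj v) *m hessian (hom D p) y *m y^T = 0.
  by rewrite scaler0 add0r.
apply: trmx_inj; rewrite !trmx_mul trmxK trmx_hessian mulmxA euler_hessian //.
by rewrite -scalemxAl Gh scaler0 trmx0.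
Qed.

End Dehomogenization.

(** * Linear independence and labels *)

Section LinearIndependence.
Context {R : realType} {n : nat} {T : finType}.

(** Independence in terms of coefficients indexed by labels and supported on A, rather than by
    positions in the sequence. *)
Lemma free_imageP (A : pred T) (F : T -> 'rV[R]_n) :
  reflect (forall a : T -> R, (forall i, ~~ A i -> a i = 0) ->
             \sum_i a i *: F i = 0 -> forall i, a i = 0)
          (free [seq F i | i in A]).
Proof.
have sumA (a : T -> R) : (forall i, ~~ A i -> a i = 0) ->
    \sum_i a i *: F i = \sum_(j < #|A|) a (enum_val j) *: (image_tuple F A)`_j.
  move=> aA; under [RHS]eq_bigr do rewrite nth_image.
  rewrite -(big_enum_val (fun i => a i *: F i)) [LHS](bigID (mem A)) /=.
  by rewrite [X in _ + X]big1 ?addr0 // => i /aA ->; rewrite scale0r.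
apply: (iffP (@freeP _ _ _ (image_tuple F A))) => [freeF a aA|freeF k sumk j].
  rewrite sumA // => /freeF a0 i; have [Ai|/aA//] := boolP (A i).
  by rewrite -(enum_rankK_in Ai Ai) a0.

(* Transports k from positions to labels: the sum has one term when i is in A and is empty
   otherwise. *)
pose a i := \sum_(j | enum_val j == i) k j.
have aE j' : a (enum_val j') = k j'.
  by rewrite /a (big_pred1 j') // => j''; rewrite (inj_eq enum_val_inj).
have aA i : ~~ A i -> a i = 0.
  move=> nAi; rewrite /a big_pred0 // => j'; apply: contraNF nAi => /eqP <-.
  exact: enum_valP.
by rewrite -aE; apply: freeF; rewrite // sumA //; under eq_bigr do rewrite aE.
Qed.

End LinearIndependence.

Section OptionSum.
Context {E I : finType}.

Definition lift_label (i : E + I) : option E + option I :=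
  match i with inl e => inl (Some e) | inr j => inr (Some j) end.

Definition lower_label (k : option E + option I) : option (E + I) :=
  match k with
  | inl (Some e) => Some (inl e)
  | inr (Some j) => Some (inr j)
  | _ => None
  end.

Lemma lift_labelK i : lower_label (lift_label i) = Some i.
Proof. by case: i. Qed.

Lemma big_lift_label (V : nmodType) (F : option E + option I -> V) :
  \sum_k F k = F (inl None) + (F (inr None) + \sum_i F (lift_label i)).
Proof.
rewrite (bigD1 (inl None)) //= (bigD1 (inr None)) //=; congr (_ + (_ + _)).
rewrite (reindex_omap lift_label lower_label); last by do 2!case.
by apply: eq_bigl; case=> i /=; rewrite eqxx.
Qed.

End OptionSum.

(** * The homogenized problem *)

Section HomogenizedProblem.
Context {R : realType} {n : nat} {E I : finType}.
Context (f : {mpoly R[n]}) (c : E + I -> {mpoly R[n]}).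
Implicit Types (x : 'rV[R]_n) (z : 'rV[R]_n.+1) (lam : E + I -> R).

Local Notation fmin := (fine (optval f c)).
Local Notation F := (hobjective f c).
Local Notation h := (hconstraints c).

Lemma msize_pdeg (p : {mpoly R[n]}) : (msize p <= (pdeg p).+1)%N.
Proof. exact: leqSpred. Qed.
Hint Resolve msize_pdeg : core.

(** Same gradient and Hessian as f, but it vanishes at minimizers, as Euler's identity requires. *)
Definition shifted : {mpoly R[n]} := f - fmin%:MP.

Lemma msize_shifted : (msize shifted <= (pdeg f).+1)%N.
Proof.
rewrite (leq_trans (msizeD_le _ _)) // geq_max msize_pdeg msizeN msizeC.
by case: (_ != _).
Qed.
Hint Resolve msize_shifted : core.

Lemma hobjectiveE : F = hom (pdeg f) shifted.
Proof. by rewrite /shifted linearB /= homC. Qed.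

Lemma hconstraintsE i : h (lift_label i) = hom (pdeg (c i)) (c i).
Proof. by case: i. Qed.

Lemma meval_hobjective t x : t != 0 ->
  F.@[hvec t (t *: x) 0] = t ^+ pdeg f * (f.@[x 0] - fmin).
Proof. by move=> t0; rewrite hobjectiveE hom_meval // mevalB mevalC. Qed.

Lemma meval_hconstraints t x i : t != 0 ->
  (h (lift_label i)).@[hvec t (t *: x) 0] = t ^+ pdeg (c i) * (c i).@[x 0].
Proof. by move=> t0; rewrite hconstraintsE hom_meval. Qed.

Lemma meval_homogenize t x (p : {mpoly R[n]}) : t != 0 ->
  (homogenize p).@[hvec t (t *: x) 0] = t ^+ pdeg p * p.@[x 0].
Proof. by move=> t0; rewrite homogenizeE_hom hom_meval. Qed.

Lemma hcone_hvec t x : 0 < t -> hcone c (hvec t (t *: x)) <-> feasible c x.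
Proof.
move=> t_gt0; have t0 := lt0r_neq0 t_gt0; split=> [[cE cI _]|[cE cI]].
  split=> [i|j].
    move: (cE i); rewrite meval_homogenize // => /eqP.
    by rewrite mulf_eq0 expf_eq0 (negPf t0) andbF => /eqP.
  move: (cI j); rewrite meval_homogenize //.
  by rewrite pmulr_rge0 ?exprn_gt0.
split=> [i|j|]; last by rewrite hvec0 ltW.
- by rewrite meval_homogenize // cE mulr0.
- by rewrite meval_homogenize // mulr_ge0 ?exprn_ge0 // ltW.
Qed.

Lemma hvec_surj z : 0 < z 0 ord0 ->
  exists x, z = hvec (z 0 ord0) (z 0 ord0 *: x).
Proof.
move=> /lt0r_neq0 z0; exists ((z 0 ord0)^-1 *: \row_i z 0 (lift ord0 i)).
rewrite scalerA divff // scale1r; apply/rowP => k.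
by case: (unliftP ord0 k) => [j ->|->]; rewrite ?hvec0 // hvecS mxE.
Qed.

Definition hscale x : R := (Num.sqrt (1 + \sum_i x 0 i ^+ 2))^-1.

Lemma sum_sqr_ge0 x : 0 <= \sum_i x 0 i ^+ 2.
Proof. by apply: sumr_ge0 => i _; rewrite sqr_ge0. Qed.

Lemma hscale_gt0 x : 0 < hscale x.
Proof. by rewrite invr_gt0 sqrtr_gt0 ltr_pwDl // sum_sqr_ge0. Qed.

Lemma hscale_neq0 x : hscale x != 0.
Proof. exact: lt0r_neq0 (hscale_gt0 x). Qed.
Hint Resolve hscale_neq0 : core.

Lemma hscale_le1 x : hscale x <= 1.
Proof.
rewrite invf_le1 ?sqrtr_gt0 ?ltr_pwDl ?sum_sqr_ge0 //.
rewrite -{1}sqrtr1 ler_sqrt ?lerDl ?sum_sqr_ge0 //.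
by rewrite ltW // ltr_pwDl // sum_sqr_ge0.
Qed.

Lemma hpointE x : hpoint x = hvec (hscale x) (hscale x *: x).
Proof.
apply/rowP => k; rewrite mxE; case: (unliftP ord0 k) => [j ->|->].
  by rewrite !hvecS mxE.
by rewrite !hvec0 mulr1.
Qed.

Lemma hpoint_normed x : hpoint x *m (hpoint x)^T = 1%:M.
Proof.
apply/rowP => k; rewrite ord1 hpointE dotTE !hvec0.
under eq_bigr do rewrite !hvecS mxE -expr2 exprMn.
rewrite -mulr_sumr -expr2 -{1}[_ ^+ 2]mulr1 -mulrDr [RHS]mxE eqxx mulr1n.
rewrite /hscale exprVn sqr_sqrtr ?addr_ge0 ?sum_sqr_ge0 //.
by rewrite mulVf // lt0r_neq0 // ltr_pwDl // sum_sqr_ge0.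
Qed.

Lemma meval_sphere z : (h (inl None)).@[z 0] = (z *m z^T) 0 0 - 1.
Proof.
rewrite /= mevalB meval1 (raddf_sum (meval _)) /= mxE; congr (_ - _).
by apply: eq_bigr => l _; rewrite rmorphXn /= mevalXU mxE expr2.
Qed.

Lemma feasible_hcone z : feasible h z -> hcone c z.
Proof.
move=> [zE zI]; split=> [i|j|].
- exact: zE (Some i).
- exact: zI (Some j).
- by have := zI None; rewrite /= mevalXU.
Qed.

Lemma feasible_hpoint x : feasible c x -> feasible h (hpoint x).
Proof.
rewrite -(hcone_hvec x (hscale_gt0 x)) -hpointE => -[cE cI c0].
split=> [[i|]|[j|]]; [exact: cE | | exact: cI | by rewrite /= mevalXU].
by rewrite meval_sphere hpoint_normed mxE subrr.
Qed.

(** * Global minimizers *)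

Section OptimalValue.
Context (bounded : (-oo < optval f c)%E).

Lemma optval_le x : feasible c x -> fmin <= f.@[x 0].
Proof.
move=> xK; have : (optval f c <= (f.@[x 0])%:E)%E.
  by apply: ereal_inf_lbound; exists x.
by case: (optval f c) bounded => [r _||] //=; rewrite lee_fin.
Qed.

Lemma le_optval (x : 'rV[R]_n) a : feasible c x ->
  (forall u, feasible c u -> a <= f.@[u 0]) -> a <= fmin.
Proof.
move=> xK a_lb; have : (a%:E <= optval f c)%E.
  by apply: le_ereal_inf_tmp => _ [u uK <-]; rewrite lee_fin a_lb.
(* A feasible point excludes the value +oo, on which [fine] would return 0. *)
have : (optval f c <= (f.@[x 0])%:E)%E by apply: ereal_inf_lbound; exists x.
by case: (optval f c) bounded => [r _||] //=; rewrite lee_fin.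
Qed.

Lemma minimizerE x : feasible c x -> minimizer f c x <-> f.@[x 0] = fmin.
Proof.
move=> xK; split=> [[_ xmin]|fx]; last by split=> // u uK; rewrite fx optval_le.
by apply/eqP; rewrite eq_le optval_le // andbT (le_optval xK).
Qed.

(** The sign is known where x_0 > 0, and F >= 0 is a closed condition by continuity. *)
Lemma hobjective_ge0 z : closed_at_infinity c -> hcone c z -> 0 <= F.@[z 0].
Proof.
move=> c_closed; rewrite -c_closed => z_cl.
suff /closureS/(_ _ z_cl) : hcone_pos c `<=` [set u | 0 <= F.@[u 0]].
  have /closure_id <- // : closed [set u : 'rV[R]_n.+1 | 0 <= F.@[u 0]].
  have /continuous_closedP/(_ [set a | 0 <= a]) := @meval_continuous _ _ F.
  by apply; apply: closed_ge.
move=> u [uK /= u0]; have [x uE] := hvec_surj u0.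
rewrite uE meval_hobjective ?lt0r_neq0 //.
apply: mulr_ge0; first by rewrite exprn_ge0 // ltW.
by rewrite subr_ge0 optval_le // -(hcone_hvec _ u0) -uE.
Qed.

Lemma minimizer_hpoint x : closed_at_infinity c -> feasible c x ->
  minimizer f c x <-> minimizer F h (hpoint x).
Proof.
move=> c_closed xK; rewrite minimizerE //; split=> [fx|[_ xmin]].
  split=> [|z /feasible_hcone zK]; first exact: feasible_hpoint.
  by rewrite hpointE meval_hobjective // fx subrr mulr0 hobjective_ge0.
(* For feasible u with scale s = [hscale u], minimality gives F(y) <= s^d (f(u) - fmin) <= f(u) -
   fmin, because 0 < s <= 1. So F(y) + fmin bounds f below on K, whence F(y) <= 0 and f(x) <=
   fmin. *)
apply/eqP; rewrite eq_le optval_le // andbT -subr_le0.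
rewrite -(pmulr_rle0 _ (exprn_gt0 (pdeg f) (hscale_gt0 x))).
rewrite -meval_hobjective // -hpointE -(gerDr fmin) (le_optval xK) // => u uK.
rewrite -lerBrDr (le_trans (xmin _ (feasible_hpoint uK))) //.
rewrite hpointE meval_hobjective // ler_piMl ?subr_ge0 ?optval_le //.
by rewrite exprn_ile1 ?hscale_le1 ?ltW ?hscale_gt0.
Qed.

End OptimalValue.

(** * Local optimality conditions *)

Section LocalConditions.
Context (x : 'rV[R]_n) (xK : feasible c x).

Local Notation t := (hscale x).
Local Notation y := (hpoint x).
(** The factor t^(deg c_i - deg f) converts multipliers at y into multipliers at x, as the gradient
    tails of c_i and f are scaled by t^(deg c_i - 1) and t^(deg f - 1). *)
Local Notation ratio i := (t ^+ pdeg (c i) / t ^+ pdeg f).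

Lemma ratio_gt0 i : 0 < ratio i.
Proof. by rewrite divr_gt0 ?exprn_gt0 ?hscale_gt0. Qed.

Lemma ratio_neq0 i : ratio i != 0.
Proof. exact: lt0r_neq0 (ratio_gt0 i). Qed.

Lemma hpoint_ord0 : y 0 ord0 = t.
Proof. by rewrite hpointE hvec0. Qed.

Lemma hpoint_meval_eq0 i : (h (lift_label i)).@[y 0] = 0 <-> (c i).@[x 0] = 0.
Proof.
rewrite hpointE meval_hconstraints //; split=> [/eqP|->]; last by rewrite mulr0.
by rewrite mulf_eq0 expf_eq0 (negPf (hscale_neq0 x)) andbF => /eqP.
Qed.

Lemma active_lift_label i : active h y (lift_label i) = active c x i.
Proof.
by apply/eqP/eqP; rewrite hpoint_meval_eq0.
Qed.

Lemma active_positivity : active h y (inr None) = false.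
Proof. by rewrite /active /= mevalXU hpoint_ord0 (negPf (hscale_neq0 x)). Qed.

Lemma gradient_sphere z : gradient (h (inl None)) z = 2 *: z.
Proof.
apply/rowP => k; rewrite !mxE /= mderivB (raddf_sum (mderiv k)).
rewrite -mpolyC1 mderivC subr0.
rewrite (raddf_sum (meval _)) /=.
under eq_bigr do rewrite expr2 mderivM mevalD !mevalM mevalXU meval_mderivXU.
rewrite (bigD1 k) //= eqxx big1 => [|l /negPf ->]; last first.
  by rewrite mulr0 mul0r addr0.
by rewrite addr0 mul1r mulr1 mulr_natl mulr2n.
Qed.

(* Pairing with y annihilates the homogenized gradients by Euler's identity,  *)
(* which isolates the multiplier of the sphere constraint.                    *)
Lemma gradient_combination d q mu : (msize q <= d.+1)%N -> q.@[x 0] = 0 ->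
  mu (inr None) = 0 -> (forall i, mu (lift_label i) * (c i).@[x 0] = 0) ->
  gradient (hom d q) y = \sum_k mu k *: gradient (h k) y <->
  mu (inl None) = 0 /\
  gradient q x =
    \sum_i (mu (lift_label i) * (t ^+ pdeg (c i) / t ^+ d)) *: gradient (c i) x.
Proof.
move=> le_qd q0 mu0 compl.
(* z is the defect of the relation at y without the sphere term, and w that of the relation at x.
   The tail of z is t^(d-1) w and z is orthogonal to y, so both vanish together. *)
pose z := gradient (hom d q) y -
  \sum_i mu (lift_label i) *: gradient (h (lift_label i)) y.
pose w := gradient q x -
  \sum_i (mu (lift_label i) * (t ^+ pdeg (c i) / t ^+ d)) *: gradient (c i) x.
have zS i : z 0 (lift ord0 i) = t ^+ d / t * w 0 i.
  rewrite /z mxE [X in _ + X]mxE summxE.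
  rewrite /w [X in _ * X]mxE [X in _ * (_ + X)]mxE summxE.
  rewrite hpointE hom_gradient_tail // mulrBr mulr_sumr.
  congr (_ - _); apply: eq_bigr => j _.
  rewrite mxE [X in _ = _ * X]mxE hconstraintsE hom_gradient_tail // !mulrA.
  congr (_ * _); have td0 := expf_neq0 d (hscale_neq0 x).
  rewrite -[LHS](mulfK td0); congr (_ / _).
  by rewrite mulrC -[RHS]mulrA -[RHS]mulrA (mulrC t^-1).
have zy : z *m y^T = 0.
  have grad_y q' d' : (msize q' <= d'.+1)%N -> 
      gradient (hom d' q') y *m y^T = (d'%:R * (t ^+ d' * q'.@[x 0]))%:M.
    move=> le_qd'; apply: trmx_inj; rewrite trmx_mul trmxK hpointE.
    by rewrite euler_gradient // hom_meval // tr_scalar_mx.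
  rewrite mulmxBl mulmx_suml grad_y // q0 !mulr0 raddf0 sub0r.
  rewrite big1 ?oppr0 // => i _.
  rewrite -scalemxAl hconstraintsE grad_y // scale_scalar_mx mulrCA.
  rewrite [_ * (_ * _.@[_])]mulrCA.
  by rewrite compl !mulr0 raddf0.
have wz : w = 0 <-> z = 0.
  split=> [w0|z0].
    apply: (eq_hvec_tail (x := x) (hscale_neq0 x)); first by rewrite -hpointE.
    by move=> i; rewrite zS w0 mxE mulr0.
  apply/rowP => i; move: (zS i); rewrite z0 !mxE => /esym/eqP.
  by rewrite !mulf_eq0 invr_eq0 expf_eq0 (negPf (hscale_neq0 x)) andbF => /eqP.
rewrite big_lift_label mu0 scale0r add0r gradient_sphere.
split=> [/eqP|[-> /eqP]].
  rewrite -subr_eq -/z => /eqP zE.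
  have mu_sphere : mu (inl None) = 0.
    move: zy; rewrite zE scalerA -scalemxAl hpoint_normed scale_scalar_mx mulr1.
    move=> /rowP/(_ 0); rewrite !mxE eqxx mulr1n => /eqP.
    by rewrite mulf_eq0 pnatr_eq0 orbF => /eqP.
  split=> //; apply/eqP; rewrite -subr_eq0 -/w; apply/eqP/wz.
  by rewrite zE mu_sphere scale0r.
rewrite -subr_eq0 -/w => /eqP/wz z0; apply/eqP.
by rewrite scale0r add0r -subr_eq0 -/z z0.
Qed.

Lemma label_ind (P : option E + option I -> Prop) :
  P (inl None) -> P (inr None) -> (forall i, P (lift_label i)) -> forall k, P k.
Proof.
by move=> Ps Pp Pl [[e|]|[j|]] //; [exact: (Pl (inl e)) | exact: (Pl (inr j))].
Qed.

Lemma multiplier_lift (a : E + I -> R) d :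
  exists mu : option E + option I -> R,
    [/\ mu (inl None) = 0, mu (inr None) = 0 &
    forall i, mu (lift_label i) * (t ^+ pdeg (c i) / t ^+ d) = a i].
Proof.
exists (fun k =>
  oapp (fun i => a i / (t ^+ pdeg (c i) / t ^+ d)) 0 (lower_label k)).
split=> // i; rewrite lift_labelK /= mulfVK //.
by rewrite mulf_neq0 ?invr_neq0 ?expf_neq0 ?hscale_neq0.
Qed.

(** [gradient_combination] with q = 0 and d = 0 matches the vanishing combinations; x_0 >= 0 is
    inactive because y_0 > 0. *)
Lemma LICQC_hpoint : LICQC c x <-> LICQC h y.
Proof.
have combi mu : (forall k, ~~ active h y k -> mu k = 0) ->
    \sum_k mu k *: gradient (h k) y = 0 <-> mu (inl None) = 0 /\
    \sum_i (mu (lift_label i) * (t ^+ pdeg (c i) / t ^+ 0)) *: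
      gradient (c i) x = 0.
  move=> mu_act.
  have mu0 : mu (inr None) = 0 by rewrite mu_act // active_positivity.
  have compl i : mu (lift_label i) * (c i).@[x 0] = 0.
    have [/eqP ->|nact] := boolP (active c x i); first by rewrite mulr0.
    by rewrite mu_act ?mul0r // active_lift_label.
  have size0 : (msize (0 : {mpoly R[n]}) <= 1)%N by rewrite msize0.
  have grad0 k u : gradient (0 : {mpoly R[k]}) u = 0.
    by apply/rowP => i; rewrite !mxE mderiv0 meval0.
  have := gradient_combination size0 (meval0 _) mu0 compl.
  rewrite linear0 !grad0.
  by split=> [/esym/H[? /esym]|[? /esym ?]]; [|apply/esym/H].
split=> /free_imageP indep; apply/free_imageP.
  move=> mu mu_act /(combi _ mu_act)[mu_s sum0].
  apply: label_ind => // [|i]; first by rewrite mu_act // active_positivity.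
  have /eqP : mu (lift_label i) * (t ^+ pdeg (c i) / t ^+ 0) = 0.
    apply: (indep _ _ sum0) => {}i nact.
    by rewrite mu_act ?mul0r // active_lift_label.
  by rewrite divr1 mulf_eq0 expf_eq0 (negPf (hscale_neq0 x)) andbF orbF => /eqP.
move=> a a_act sum0 i; have [mu [mu_s mu_p muE]] := multiplier_lift a 0.
have mu_act k : ~~ active h y k -> mu k = 0.
  elim/label_ind: k => // j; rewrite active_lift_label => /a_act/eqP.
  rewrite -muE divr1 mulf_eq0 expf_eq0 (negPf (hscale_neq0 x)) andbF orbF.
  by move/eqP.
rewrite -muE (indep mu) ?mul0r //; apply/combi => //; split=> //.
by under eq_bigr do rewrite muE.
Qed.

(** * Multipliers, strict complementarity and second-order conditions at a minimizer *)

Section Multipliers.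
Context (fx : f.@[x 0] = fmin).

Lemma shifted_root : shifted.@[x 0] = 0.
Proof. by rewrite mevalB mevalC fx subrr. Qed.

Lemma gradient_shifted u : gradient shifted u = gradient f u.
Proof. by apply/rowP => i; rewrite !mxE mderivB mderivC subr0. Qed.

Lemma hessian_shifted u : hessian shifted u = hessian f u.
Proof. by apply/matrixP => i j; rewrite !mxE mderivB mderivC subr0. Qed.

Lemma multipliers_compl lam i :
  multipliers f c x lam -> lam i * (c i).@[x 0] = 0.
Proof.
move=> [_ compl]; case: i => [e|j]; last by have [_] := compl j.
by have [-> _] := xK; rewrite mulr0.
Qed.

(** [gradient_combination] for f - fmin. Complementarity with y_0 > 0 kills the multiplier of x_0 >=
    0, and positive ratios preserve signs. *)
Lemma multipliers_hpoint mu :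
  multipliers F h y mu <->
  [/\ mu (inl None) = 0, mu (inr None) = 0 &
      multipliers f c x (fun i => mu (lift_label i) * ratio i)].
Proof.
have hcomb := gradient_combination msize_shifted shifted_root.
have mulc i : (h (lift_label i)).@[y 0] = t ^+ pdeg (c i) * (c i).@[x 0].
  by rewrite hpointE meval_hconstraints.
have tD i : t ^+ pdeg (c i) != 0 by rewrite expf_neq0 ?hscale_neq0.
split=> [[eqF compl]|[mu_s mu_p lamP]].
  have mu_p : mu (inr None) = 0.
    have [_ /eqP] := compl None; rewrite /= mevalXU hpoint_ord0.
    by rewrite mulf_eq0 (negPf (hscale_neq0 x)) orbF => /eqP.
  have muc i : mu (lift_label i) * (c i).@[x 0] = 0.
    case: i => [e|j]; first by have [-> _] := xK; rewrite mulr0.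
    have [_ /eqP] := compl (Some j).
    by rewrite (mulc (inr j)) mulrCA mulf_eq0 (negPf (tD _)) => /eqP.
  move: eqF; rewrite hobjectiveE hcomb // gradient_shifted => -[mu_s eqf].
  split=> //; split=> // j; split; last by rewrite mulrAC (muc (inr j)) mul0r.
  by apply: mulr_ge0; [have [] := compl (Some j) | exact: ltW (ratio_gt0 _)].
have muc i : mu (lift_label i) * (c i).@[x 0] = 0.
  have := multipliers_compl i lamP; rewrite mulrAC => /eqP.
  by rewrite mulf_eq0 (negPf (ratio_neq0 i)) orbF => /eqP.
have [eqf compl] := lamP; split.
  by rewrite hobjectiveE hcomb // gradient_shifted.
case=> [j|]; last by rewrite mu_p mul0r.
split; last by rewrite (mulc (inr j)) mulrCA (muc (inr j)) mulr0.
by have [+ _] := compl j; rewrite pmulr_lge0 ?ratio_gt0.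
Qed.

Lemma multipliers_hpoint_ex lam : multipliers f c x lam ->
  exists2 mu, multipliers F h y mu & lam = fun i => mu (lift_label i) * ratio i.
Proof.
have [mu [mu_s mu_p muE]] := multiplier_lift lam (pdeg f).
have -> : lam = fun i => mu (lift_label i) * ratio i.
  by apply/funext => i; rewrite muE.
by move=> lamP; exists mu => //; apply/multipliers_hpoint.
Qed.

(** Rescaling two nonnegative numbers by positive factors does not change whether their sum is
    positive; for x_0 >= 0 the sum is y_0 > 0. *)
Lemma SCC_hpoint : SCC f c x <-> SCC F h y.
Proof.
have pos (a b r s : R) : 0 <= a -> 0 <= b -> 0 < r -> 0 < s ->
    0 < a * r + b <-> 0 < a + s * b.
  move=> a0 b0 r0 s0; rewrite !lt_neqAle ![0 == _]eq_sym.
  have [a_r s_b] : 0 <= a * r /\ 0 <= s * b by rewrite !mulr_ge0 // ltW.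
  by rewrite !paddr_eq0 // !addr_ge0 // !mulf_eq0 (gt_eqF r0) (gt_eqF s0) orbF.
have strict mu : multipliers F h y mu ->
    (forall j,
      0 < mu (lift_label (inr j)) * ratio (inr j) + (c (inr j)).@[x 0]) <->
    (forall j, 0 < mu (inr j) + (h (inr j)).@[y 0]).
  move=> muP; have [_ mu_p _] := (multipliers_hpoint mu).1 muP.
  have [_ compl] := muP; have [_ cI] := xK.
  have posj j :
      0 < mu (lift_label (inr j)) * ratio (inr j) + (c (inr j)).@[x 0] <->
      0 < mu (inr (Some j)) + (h (inr (Some j))).@[y 0].
    rewrite hpointE (meval_hconstraints _ (inr j)) //; apply: pos => //.
    - by case: (compl (Some j)).
    - exact: ratio_gt0.
    - by rewrite exprn_gt0 ?hscale_gt0.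
  split=> [H [j|]|H j]; [exact/posj | | exact/posj].
  by rewrite mu_p add0r /= mevalXU hpoint_ord0 hscale_gt0.
split=> [[lam /multipliers_hpoint_ex[mu muP ->]]|[mu muP]].
  by move=> H; exists mu => //; apply/strict.
move=> /(strict _ muP) H; exists (fun i => mu (lift_label i) * ratio i) => //.
by have [] := (multipliers_hpoint mu).1 muP.
Qed.

Lemma tproj_gradient v i : active c x i ->
  v *m (gradient (h (lift_label i)) y)^T = 0 <->
  tproj x v *m (gradient (c i) x)^T = 0.
Proof.
move=> /eqP ci0; rewrite hconstraintsE hpointE gradient_tproj //.
split=> [/eqP|->]; last by rewrite scaler0.
rewrite scalemx_eq0 mulf_eq0 invr_eq0 expf_eq0 (negPf (hscale_neq0 x)) andbF.
by move/eqP.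
Qed.

(** [hessian_tproj] applies termwise: the multiplier equation makes [tproj x v] orthogonal to the
    gradient of f too, and inactive constraints and the sphere have multiplier 0. The ratios turn
    each factor t^(deg c_i - 2) into the common t^(deg f - 2). *)
Lemma hessian_lagrangian mu v : multipliers F h y mu ->
  (forall i, active c x i -> tproj x v *m (gradient (c i) x)^T = 0) ->
  v *m hessian (lagrangian F h mu) y *m v^T =
  (t ^+ pdeg f / t ^+ 2) *:
    (tproj x v *m
     hessian (lagrangian f c (fun i => mu (lift_label i) * ratio i)) x *m
     (tproj x v)^T).
Proof.
move=> muP vg0; have [mu_s mu_p lamP] := (multipliers_hpoint mu).1 muP.
have lam0 i : ~~ active c x i -> mu (lift_label i) = 0.
  move=> nact; have /eqP := multipliers_compl i lamP.
  rewrite mulf_eq0 [X in X || _]mulf_eq0 (negPf (ratio_neq0 i)) orbF.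
  by case/orP=> [/eqP //|act]; case/negP: nact.
have vf0 : tproj x v *m (gradient shifted x)^T = 0.
  rewrite gradient_shifted; have [-> _] := lamP.
  rewrite linear_sum mulmx_sumr big1 // => i _; rewrite linearZ /= -scalemxAr.
  have [/vg0 ->|/lam0 ->] := boolP (active c x i); first by rewrite scaler0.
  by rewrite mul0r scale0r.
rewrite /lagrangian hobjectiveE [in LHS]hessianB [in RHS]hessianB.
rewrite !hessian_sum big_lift_label mu_s mu_p !scale0r.
have hess0 : hessian (0 : {mpoly R[n.+1]}) y = 0.
  by apply/matrixP => i j; rewrite !mxE !mderiv0 meval0.
rewrite hess0 !add0r !mulmxBr !mulmxBl !mulmx_sumr !mulmx_suml.
rewrite scalerBr scaler_sumr.
congr (_ - _).
  by rewrite hpointE hessian_tproj ?hessian_shifted ?shifted_root.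
apply: eq_bigr => i _; rewrite !hessianZ -!scalemxAr -!scalemxAl.
have [act|/lam0 ->] := boolP (active c x i); last first.
  by rewrite mul0r !scale0r scaler0.
rewrite hconstraintsE hpointE hessian_tproj ?vg0 //; last exact/eqP.
rewrite !scalerA; congr (_ *: _); rewrite [RHS]mulrCA; congr (_ * _).
by rewrite [RHS]mulrC mulrA mulfVK ?expf_neq0 ?hscale_neq0.
Qed.

Lemma hpoint_orthogonal (v : 'rV[R]_n.+1) :
  v *m (gradient (h (inl None)) y)^T = 0 <-> v *m y^T = 0.
Proof.
rewrite gradient_sphere linearZ /= -scalemxAr.
split=> [/eqP|->]; last exact: scaler0.
by rewrite scalemx_eq0 pnatr_eq0 => /eqP.
Qed.

Lemma tproj_neq0 (v : 'rV[R]_n.+1) : v *m y^T = 0 -> v != 0 -> tproj x v != 0.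
Proof.
move=> vy; apply: contra_neq => w0.
have vE := tprojK x (hscale_neq0 x) v; rewrite w0 -hpointE in vE.
have hvec00 : hvec 0 (0 : 'rV[R]_n) = 0.
  apply/rowP => k; rewrite [RHS]mxE.
  by case: (unliftP ord0 k) => [j ->|->]; rewrite ?hvec0 // hvecS mxE.
move: vy; rewrite vE hvec00 addr0 -scalemxAl hpoint_normed scale_scalar_mx.
rewrite mulr1 => /rowP/(_ 0); rewrite !mxE eqxx mulr1n => ->.
by rewrite scale0r.
Qed.

Lemma tproj_surj (w : 'rV[R]_n) : exists2 v, v *m y^T = 0 & tproj x v = w.
Proof.
pose a := (hvec 0 w *m y^T) 0 0.
(* The orthogonal projection of (0, w) off the unit vector y; subtracting a multiple of y leaves
   [tproj x] unchanged. *)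
exists (hvec 0 w - a *: y).
  rewrite mulmxBl -scalemxAl hpoint_normed scale_scalar_mx mulr1.
  by rewrite [X in X - _]mx11_scalar subrr.
have vE k : (hvec 0 w - a *: y) 0 k = hvec 0 w 0 k - a * y 0 k.
  by rewrite mxE [X in _ + X]mxE [X in _ - X]mxE.
apply/rowP => i; rewrite mxE !vE hpointE !hvecS !hvec0 mxE.
by rewrite sub0r mulNr opprK mulrA subrK.
Qed.

(** The tangent vectors at y are the v orthogonal to y, because of the sphere, with [tproj x v]
    tangent at x. By [tproj_neq0] and [tproj_surj] their nonzero elements correspond to the nonzero
    tangent vectors at x. *)
Lemma SOSC_hpoint : SOSC f c x <-> SOSC F h y.
Proof.
have t_pos : 0 < t ^+ pdeg f / t ^+ 2.
  by rewrite divr_gt0 ?exprn_gt0 ?hscale_gt0.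
split=> [[lam /multipliers_hpoint_ex[mu muP ->] pos]|[mu muP pos]].
  exists mu => // v v0 v_orth.
  have vg0 i : active c x i -> tproj x v *m (gradient (c i) x)^T = 0.
    move=> act; apply/tproj_gradient => //; apply: v_orth.
    by rewrite active_lift_label.
  rewrite hessian_lagrangian // mxE pmulr_rgt0 //; apply: pos => //.
  apply: tproj_neq0 => //; apply/hpoint_orthogonal/v_orth.
  rewrite /active /= -[X in X == _]/((h (inl None)).@[y 0]) meval_sphere.
  by rewrite hpoint_normed mxE subrr.
exists (fun i => mu (lift_label i) * ratio i).
  by have [] := (multipliers_hpoint mu).1 muP.
move=> w w0 w_orth; have [v vy vw] := tproj_surj w.
have vg0 i : active c x i -> tproj x v *m (gradient (c i) x)^T = 0.
  by rewrite vw; exact: w_orth.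
rewrite -(pmulr_rgt0 _ t_pos); move: (hessian_lagrangian muP vg0).
move=> /matrixP/(_ 0 0); rewrite vw [RHS]mxE => <-; apply: pos.
  apply: contra_neq w0 => v0; rewrite -vw v0.
  by apply/rowP => i; rewrite !mxE mul0r subr0.
elim/label_ind => [_||i]; first exact/hpoint_orthogonal.
  by rewrite active_positivity.
by rewrite active_lift_label => act; apply/tproj_gradient => //; exact: vg0.
Qed.

End Multipliers.

End LocalConditions.

End HomogenizedProblem.

Theorem theorem4p4 (R : realType) (n : nat) (E I : finType)
    (f : {mpoly R[n]}) (c : E + I -> {mpoly R[n]}) :
  (-oo < optval f c)%E ->
  closed_at_infinity c ->
  forall x : 'rV[R]_n, feasible c x ->
    (minimizer f c x <->
     minimizer (hobjective f c) (hconstraints c) (hpoint x)) /\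
    (minimizer f c x ->
     [/\ LICQC c x <-> LICQC (hconstraints c) (hpoint x),
         LICQC c x ->
           (SCC f c x <->
            SCC (hobjective f c) (hconstraints c) (hpoint x)) &
         LICQC c x ->
           (SOSC f c x <->
            SOSC (hobjective f c) (hconstraints c) (hpoint x))]).
Proof.
move=> bounded c_closed x xK; split; first exact: minimizer_hpoint.
move=> /(minimizerE bounded xK) fx; split=> [|_|_].
- exact: LICQC_hpoint.
- exact: SCC_hpoint.
- exact: SOSC_hpoint.
Qed.
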